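(* For every multiarrangement $(\mathcal{A},\mu)$ in $\mathbb{K}^2$, the following recursive algorithm $\mathtt{ALG3}$ constructs a homogeneous basis $(\theta_1,\theta_2)$ for $D(\mathcal{A},\mu)$ (that is, it terminates and its output is such a basis). Input: $(\mathcal{A},\mu)$. Output: $(\theta_1,\theta_2)$. Procedure: (1) If $\mathcal{A}=\emptyset$, then let $\theta_1=\partial_x$ and $\theta_2=\partial_y$, and finish the procedure. (2) Let $H$ be a hyperplane in $\operatorname{supp}(\mu)$. (3) Let $\mu'$ be the map such that $\mu'(H)=\mu(H)-1$ and $\mu'(H')=\mu(H')$ for $H'\in\mathcal{A}\setminus\{H\}$. (4) Let $\mathcal{A}'=\operatorname{supp}(\mu')$. (5) Let $(\theta_1',\theta_2')$ be the resulting basis of $\mathtt{ALG3}(\mathcal{A}',\mu')$. (6) Let $\alpha\in S_1$ be a linear form such that $\ker(\alpha)=H$. (7) Let $(\theta_1,\theta_2)$ be the resulting basis of $\mathtt{ALG1}(\theta_1',\theta_2',\alpha,\mu'(H))$.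
   Context: Let $\mathbb{K}$ be a field, $V=\mathbb{K}^2$ with coordinates $x,y$, and $S=\mathbb{K}[x,y]=\bigoplus_{i\ge 0}S_i$ graded by degree, so $S_1$ is the space of linear forms. A central arrangement $\mathcal{A}$ is a finite collection of hyperplanes through the origin (i.e. lines through the origin) in $V$. A multiarrangement $(\mathcal{A},\mu)$ is a central arrangement $\mathcal{A}$ with a map $\mu:\mathcal{A}\to\mathbb{Z}_{>0}$; it is identified with the map $\mu$ from all hyperplanes through the origin to $\mathbb{Z}_{\ge 0}$ obtained by setting $\mu(H)=0$ for $H\notin\mathcal{A}$, so that $\mathcal{A}=\operatorname{supp}(\mu)=\{H:\mu(H)\ne 0\}$. The module of logarithmic vector fields $D(\mathcal{A},\mu)$ is the $S$-module of all derivations $\theta=f\partial_x+g\partial_y$ with $f,g\in S$ such that $\theta(\alpha)$ lies in the ideal $(\alpha^{\mu(\ker(\alpha))})$ of $S$ for each $\alpha\in S_1\setminus\{0\}$. It is graded: $D(\mathcal{A},\mu)_i$ consists of those $f\partial_x+g\partial_y\in D(\mathcal{A},\mu)$ with $f,g\in S_i$. A nonzero element of $D(\mathcal{A},\mu)_i$ is homogeneous of degree $i$. A homogeneous basis is an $S$-module basis consisting of (two) homogeneous elements. The algorithm $\mathtt{ALG1}(\theta_1,\theta_2,\alpha,m)$, with $\theta_1,\theta_2$ homogeneous derivations, $\alpha=\alpha_x x+\alpha_y y\in S_1\setminus\{0\}$ and $m\in\mathbb{Z}_{\ge 0}$, returns $(\theta_1',\theta_2')$ defined as follows. (1) If $\deg(\theta_1)<\deg(\theta_2)$,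 swap $\theta_1$ and $\theta_2$. (2) Let $g(x,y)=\theta_2(\alpha)/\alpha^m$. (3) If $g(\alpha_y,-\alpha_x)=0$, let $\theta_1'=\alpha\cdot\theta_1$, $\theta_2'=\theta_2$, and finish. (4) Let $f(x,y)=\theta_1(\alpha)/\alpha^m$. (5) If $f(\alpha_y,-\alpha_x)=0$, let $\theta_1'=\theta_1$, $\theta_2'=\alpha\cdot\theta_2$, and finish. (6) Let $q(x,y)$ be a homogeneous polynomial of degree $\deg(\theta_1)-\deg(\theta_2)$ satisfying $f(\alpha_y,-\alpha_x)+g(\alpha_y,-\alpha_x)q(\alpha_y,-\alpha_x)=0$. (7) Let $\theta_1'=\theta_1+q(x,y)\cdot\theta_2$ and $\theta_2'=\alpha\cdot\theta_2$. *)

(* Defs.v *)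
From HB Require Import structures.
From mathcomp Require Import all_boot all_algebra.
From mathcomp Require Import finmap.
From mathcomp.multinomials Require Import mpoly.

Set Implicit Arguments.
Unset Strict Implicit.
Unset Printing Implicit Defensive.

Import GRing.Theory.
Local Open Scope ring_scope.

(* The plane V = K^2 is 'rV[K]_2, S = K[x,y] is {mpoly K[2]}, and the indices
   0 and 1 of 'I_2 stand for x and y. *)

Definition hyperplane (K : fieldType) : choiceType :=
  {U : {vspace 'rV[K]_2} | \dim U == 1%N}.

(* A multiarrangement, identified with its multiplicity map on all hyperplanes;
   the underlying arrangement is [finsupp mu]. *)
Definition multiarr (K : fieldType) : Type :=
  {fsfun hyperplane K -> nat with 0%N}.

(* The row vector (f, g) stands for f d/dx + g d/dy. *)
Definition derivation (K : fieldType) : Type := 'rV[{mpoly K[2]}]_2.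

Section Defs.
Variable K : fieldType.
Local Notation S := {mpoly K[2]}.
Local Notation deriv := (derivation K).
Implicit Types (H : hyperplane K) (mu : multiarr K) (alpha p f g q : S).
Implicit Types (theta t : deriv).

Definition d_x : deriv := delta_mx 0 0.
Definition d_y : deriv := delta_mx 0 1.

Definition der_app theta p : S := \sum_(i < 2) theta 0 i * p^`M(i).

Definition linear_form alpha : Prop := alpha \is 1.-homog.

Definition is_ker alpha H : Prop :=
  forall v : 'rV[K]_2, (v \in val H) = (alpha.@[fun i => v 0 i] == 0).

Definition in_ideal_pow alpha (n : nat) p : Prop :=
  exists h : S, p = h * alpha ^+ n.

Definition logD mu theta : Prop :=
  forall alpha H, linear_form alpha -> alpha != 0 -> is_ker alpha H ->
    in_ideal_pow alpha (mu H) (der_app theta alpha).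

Definition homog_der (d : nat) theta : Prop :=
  theta != 0 /\ forall i : 'I_2, theta 0 i \is d.-homog.

Definition basis_logD mu t1 t2 : Prop :=
  [/\ logD mu t1, logD mu t2,
      forall a b : S, a *: t1 + b *: t2 = 0 -> a = 0 /\ b = 0
    & forall theta, logD mu theta ->
        exists a b : S, theta = a *: t1 + b *: t2].

Definition homog_basis mu t1 t2 : Prop :=
  [/\ basis_logD mu t1 t2,
      exists d1, homog_der d1 t1
    & exists d2, homog_der d2 t2].

(* The degree of a nonzero homogeneous derivation; recall that
   [msize p] is one more than the degree of [p], and [msize 0 = 0]. *)
Definition deg_der theta : nat := (\max_(i < 2) msize (theta 0%R i)).-1.

(* The value p(alpha_y, -alpha_x). *)
Definition eval_on alpha p : K :=
  p.@[fun i : 'I_2 => if i == 0 then alpha@_U_(1) else - alpha@_U_(0)].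

(* The polynomial theta(alpha) / alpha^m, when the division is exact. *)
Definition is_quot theta alpha (m : nat) g : Prop :=
  g * alpha ^+ m = der_app theta alpha.

(* ALG1 once its inputs are ordered so that deg t1 >= deg t2.  It is a relation
   between inputs and outputs because of the free choice of q; it relates the
   inputs to nothing if an instruction that is reached cannot be performed
   (inexact division, or no suitable q). *)
Variant ALG1_ordered t1 t2 alpha (m : nat) : deriv -> deriv -> Prop :=
| ALG1_g0 g of is_quot t2 alpha m g & eval_on alpha g = 0 :
    ALG1_ordered t1 t2 alpha m (alpha *: t1) t2
| ALG1_f0 g f of is_quot t2 alpha m g & eval_on alpha g <> 0
             & is_quot t1 alpha m f & eval_on alpha f = 0 :
    ALG1_ordered t1 t2 alpha m t1 (alpha *: t2)
| ALG1_q g f q of is_quot t2 alpha m g & eval_on alpha g <> 0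
             & is_quot t1 alpha m f & eval_on alpha f <> 0
             & q \is (deg_der t1 - deg_der t2)%N.-homog
             & eval_on alpha f + eval_on alpha g * eval_on alpha q = 0 :
    ALG1_ordered t1 t2 alpha m (t1 + q *: t2) (alpha *: t2).

Definition ALG1 t1 t2 alpha (m : nat) : deriv -> deriv -> Prop :=
  if (deg_der t1 < deg_der t2)%N then ALG1_ordered t2 t1 alpha m
  else ALG1_ordered t1 t2 alpha m.

Definition decr mu H : multiarr K := [fsfun mu with H |-> (mu H).-1].

(* [ALG3 mu t1 t2]: some finite execution of ALG3 on mu, for some choice of
   the hyperplanes H, the linear forms alpha and the polynomials q, outputs
   (t1, t2). *)
Inductive ALG3 mu : deriv -> deriv -> Prop :=
| ALG3_empty of finsupp mu = fset0 : ALG3 mu d_x d_y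
| ALG3_rec H alpha t1' t2' t1 t2 of
      H \in finsupp mu
    & ALG3 (decr mu H) t1' t2'
    & linear_form alpha & is_ker alpha H
    & ALG1 t1' t2' alpha (decr mu H H) t1 t2 :
    ALG3 mu t1 t2.

(* Every execution of ALG3 on mu is finite and never gets stuck, whatever
   choices are made: for every H in the support the recursive call has this
   property, a defining form of H can be found, and ALG1 can be carried out on
   every possible result of the call, with every defining form of H.  There is
   nothing to require when the support is empty. *)
Inductive ALG3_terminates mu : Prop :=
| ALG3_terminates_intro of
      (forall H, H \in finsupp mu -> ALG3_terminates (decr mu H))
    & (forall H, H \in finsupp mu ->
         exists alpha, linear_form alpha /\ is_ker alpha H)
    & (forall H alpha t1' t2', H \in finsupp mu ->
         ALG3 (decr mu H) t1' t2' -> linear_form alpha -> is_ker alpha H ->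
         exists t1 t2, ALG1 t1' t2' alpha (decr mu H H) t1 t2).

End Defs.

(* Main.v *)
Require Import Defs.
From mathcomp Require Import all_boot all_algebra.
From mathcomp Require Import finmap ring.
From mathcomp.multinomials Require Import mpoly.

(** Let H be a line in the support of mu, alpha a form with kernel H, m + 1 the
    multiplicity of H, and mu' the result of lowering it to m.  A derivation
    theta in D(mu') has a quotient theta(alpha) / alpha^m, and it lies in D(mu)
    iff alpha divides this quotient ([logD_incr]).  For a basis t1, t2 of D(mu')
    with quotients f, g, the quotient of a t1 + b t2 is a f + b g, so

      D(mu) = { a t1 + b t2 : alpha divides a f + b g }.

    Suppose that alpha divides f and not g.  Since alpha is prime, the condition
    becomes that alpha divides b, and t1, alpha t2 is a basis of D(mu)
    ([basis_step]).  The three branches of ALG1 reduce to this situation: the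
    first two directly, up to the order of t1 and t2, and the third after t1 is
    replaced by t1 + q t2, whose quotient is f + q g ([basis_shear]).

    It remains to see that alpha cannot divide both f and g, as the first branch
    takes for granted.  If it did, it would divide the quotient of every element
    of D(mu').  But if Q is a product of powers of the forms of the other lines,
    then alpha^m Q d/dx and alpha^m Q d/dy lie in D(mu') and their quotients are
    alpha_x Q and alpha_y Q, which are not both divisible by alpha
    ([exists_exact_contact], [basis_contact]).

    The algorithm tests divisibility by alpha through the value at the point
    p = (alpha_y, -alpha_x), which spans H.  One value decides it because the
    quotients are homogeneous ([dhomog_cancel], [ideal1_eval_on]).  Both this criterion and the primality of alpha come from
    one ring morphism: if beta is a linear form with beta(p) = 1, substituting
    p beta for the variables is an endomorphism of S whose kernel is the ideal
    (alpha), and it maps a homogeneous F of degree d to F(p) beta^d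
    ([ideal1P], [collapse_homog]).

    Each recursive call lowers the sum of the multiplicities by one, whence
    termination ([decr_ind]). *)

Set Implicit Arguments.
Unset Strict Implicit.
Unset Printing Implicit Defensive.
Import GRing.Theory.
Local Open Scope ring_scope.

Lemma I2_case (i : 'I_2) : i = 0 \/ i = 1.
Proof. by case: i => [[|[|//]]] hi; [left|right]; apply/val_inj. Qed.

Lemma big_I2 (V : nmodType) (F : 'I_2 -> V) : \sum_(i < 2) F i = F 0 + F 1.
Proof.
by rewrite !big_ord_recl big_ord0 addr0; congr (_ + F _); apply/val_inj.
Qed.

(** * Homogeneous polynomials *)

Section Homogeneous.
Variables (n : nat) (R : idomainType).
Implicit Types (p q : {mpoly R[n]}).

Lemma dhomog_msize_eq d p : p \is d.-homog -> p != 0 -> msize p = d.+1.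
Proof.
move=> hp nz; rewrite -(dhomog_uniq nz (dhomog_msize hp) hp).
exact: mpolySpred.
Qed.

Lemma pihomogM_homog k d p q : q \is d.-homog ->
  pihomog mdeg (k + d) (p * q) = pihomog mdeg k p * q.
Proof.
move=> hq; elim/mpolyind: p => [|c m p _ _ IH].
  by rewrite mul0r !pihomog0 mul0r.
rewrite mulrDl !pihomogD IH mulrDl -scalerAl !linearZ /= -scalerAl.
congr (_ *: _ + _); rewrite pihomogX.
have hm : 'X_[R, m] \is (mdeg m).-homog by rewrite dhomogX.
case: eqP => [<-|/eqP ne]; first by rewrite pihomog_dE // dhomogM.
by rewrite mul0r (pihomog_ne0 _ (dhomogM hm hq)) // eqn_add2r.
Qed.

(** Multiplication by q shifts the homogeneous components of p by e and kills
    none of them, so that p has as many nonzero components as p q.  If d < e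
    this forces p = 0, which is homogeneous of every degree. *)
Lemma dhomog_cancel d e p q : q != 0 -> q \is e.-homog ->
  p * q \is d.-homog -> p \is (d - e)%N.-homog.
Proof.
move=> nz hq hpq.
rewrite (pihomog_partitionE (leqnn (mmeasure mdeg p))).
apply: rpred_sum => k _.
have [->|ne] := eqVneq (nat_of_ord k) (d - e)%N; first exact: pihomogP.
suff -> : pihomog mdeg k p = 0 by apply: dhomog0.
apply: (mulIf nz); rewrite mul0r -(pihomogM_homog _ _ hq) (pihomog_ne0 _ hpq) //.
by apply: contraNneq ne => ->; rewrite addnK.
Qed.

End Homogeneous.

(** * Linear forms *)

Section LinearForms.
Variable K : fieldType.
Local Notation S := {mpoly K[2]}.
Implicit Types (alpha beta p q : S).

Definition lin (a b : K) : S := a *: 'X_0 + b *: 'X_1.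

Lemma mcoeff_lin0 a b : (lin a b)@_U_(0) = a.
Proof.
by rewrite /lin mcoeffD !mcoeffZ !mcoeffX eqxx eq_mnm1 mulr1 mulr0 addr0.
Qed.

Lemma mcoeff_lin1 a b : (lin a b)@_U_(1) = b.
Proof.
by rewrite /lin mcoeffD !mcoeffZ !mcoeffX eqxx eq_mnm1 mulr1 mulr0 add0r.
Qed.

Lemma linear_form_lin a b : linear_form (lin a b).
Proof. by apply: dhomogD; apply: dhomogZ; rewrite dhomogX /= mdeg1. Qed.

Lemma meval_lin a b v : (lin a b).@[v] = a * v 0 + b * v 1.
Proof. by rewrite mevalD !mevalZ !mevalXU. Qed.

Lemma linear_formE alpha :
  linear_form alpha -> alpha = lin alpha@_U_(0) alpha@_U_(1).
Proof.
move=> ha; apply/mpolyP => m.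
have [dm|dm] := eqVneq (mdeg m) 1%N; last first.
  by rewrite !(dhomog_nemf_coeff _ dm) //; apply: linear_form_lin.
have /mdeg1P [i /eqP ->] : mdeg m == 1%N by rewrite dm.
by case: (I2_case i) => ->; rewrite ?mcoeff_lin0 ?mcoeff_lin1.
Qed.

Lemma linear_form_neq0 alpha : linear_form alpha -> alpha != 0 ->
  exists i, alpha@_U_(i) != 0.
Proof.
move=> ha nz.
have [a0|a0] := eqVneq (mcoeff U_(0%R)%MM alpha) 0; last by exists 0.
exists 1; apply: contra nz => /eqP a1.
by rewrite (linear_formE ha) a0 a1 /lin !scale0r addr0.
Qed.

Lemma scale_lin c a b : c *: lin a b = lin (c * a) (c * b).
Proof. by rewrite scalerDr !scalerA. Qed.

Lemma subr_lin a b c d : lin a b - lin c d = lin (a - c) (b - d).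
Proof. by rewrite /lin opprD addrACA -!scalerBl. Qed.

Lemma mpolyX0_lin : 'X_0 = lin 1 0.
Proof. by rewrite /lin scale1r scale0r addr0. Qed.

Lemma mpolyX1_lin : 'X_1 = lin 0 1.
Proof. by rewrite /lin scale1r scale0r add0r. Qed.

Definition direction alpha (i : 'I_2) : K :=
  if i == 0 then alpha@_U_(1) else - alpha@_U_(0).

Lemma eval_onE alpha p : eval_on alpha p = p.@[direction alpha].
Proof. by []. Qed.

Lemma eval_on_lin alpha a b :
  eval_on alpha (lin a b) = a * alpha@_U_(1) - b * alpha@_U_(0).
Proof. by rewrite eval_onE meval_lin /direction /= mulrN. Qed.

Lemma eval_on_self alpha : linear_form alpha -> eval_on alpha alpha = 0.
Proof.
by move=> /linear_formE e; rewrite {2}e eval_on_lin mulrC subrr.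
Qed.

Lemma exists_transverse alpha : linear_form alpha -> alpha != 0 ->
  exists a b, eval_on alpha (lin a b) = 1.
Proof.
move=> ha /(linear_form_neq0 ha) [i]; case: (I2_case i) => -> nz.
- exists 0, (- (alpha@_U_(0))^-1).
  by rewrite eval_on_lin mul0r sub0r mulNr opprK mulVf.
- by exists (alpha@_U_(1))^-1, 0; rewrite eval_on_lin mul0r subr0 mulVf.
Qed.

(** For (a, b) with a alpha_y - b alpha_x = 1, the factor is
    a beta_y - b beta_x: both equations are linear combinations of this identity
    and of the vanishing of the determinant of alpha and beta. *)
Lemma proportional alpha beta : linear_form alpha -> alpha != 0 ->
  linear_form beta -> eval_on alpha beta = 0 -> exists c, beta = c *: alpha.
Proof.
move=> ha nz hb; have [a [b]] := exists_transverse ha nz.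
rewrite {1}(linear_formE hb) !eval_on_lin => h1 h2.
exists (a * beta@_U_(1) - b * beta@_U_(0)).
rewrite [LHS](linear_formE hb) [in RHS](linear_formE ha) scale_lin.
move: h1 h2.
set x := mcoeff U_(0%R)%MM alpha; set y := mcoeff U_(1%R)%MM alpha.
set z := mcoeff U_(0%R)%MM beta; set t := mcoeff U_(1%R)%MM beta => h1 h2.
congr lin; apply: subr0_eq.
- transitivity (z * (1 - (a * y - b * x)) + a * (z * y - t * x)); first by ring.
  by rewrite h1 h2 subrr !mulr0 addr0.
- transitivity (t * (1 - (a * y - b * x)) + b * (z * y - t * x)); first by ring.
  by rewrite h1 h2 subrr !mulr0 addr0.
Qed.

Lemma in_ideal_powD alpha n p q : in_ideal_pow alpha n p ->
  in_ideal_pow alpha n q -> in_ideal_pow alpha n (p + q).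
Proof. by move=> [h ->] [k ->]; exists (h + k); rewrite mulrDl. Qed.

Lemma in_ideal_powMl alpha n p q : in_ideal_pow alpha n q ->
  in_ideal_pow alpha n (p * q).
Proof. by move=> [h ->]; exists (p * h); rewrite mulrA. Qed.

Lemma in_ideal_pow0 alpha n : in_ideal_pow alpha n 0.
Proof. by exists 0; rewrite mul0r. Qed.

Lemma in_ideal_pow_self alpha n : in_ideal_pow alpha n (alpha ^+ n).
Proof. by exists 1; rewrite mul1r. Qed.

(** Restriction to the line ker(alpha), whose coordinate ring is realised inside
    S as the polynomials in beta. *)
Definition collapse alpha beta p : S :=
  p \mPo [tuple direction alpha i *: beta | i < 2].

Lemma collapseX alpha beta (i : 'I_2) :
  collapse alpha beta 'X_i = direction alpha i *: beta.
Proof.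
by rewrite /collapse comp_mpolyXU (nth_map i) ?size_enum_ord ?nth_ord_enum.
Qed.

Lemma collapse1 alpha beta : collapse alpha beta 1 = 1.
Proof. exact: rmorph1. Qed.

Lemma collapseM alpha beta : {morph collapse alpha beta : p q / p * q}.
Proof. by move=> p q; rewrite /collapse rmorphM. Qed.

Lemma collapseD alpha beta : {morph collapse alpha beta : p q / p + q}.
Proof. by move=> p q; rewrite /collapse rmorphD. Qed.

Lemma collapseZ alpha beta c p :
  collapse alpha beta (c *: p) = c *: collapse alpha beta p.
Proof. by rewrite /collapse comp_mpolyZ. Qed.

Lemma collapse_self alpha beta : linear_form alpha ->
  collapse alpha beta alpha = 0.
Proof.
move=> /linear_formE e; rewrite {2}e collapseD !collapseZ !collapseX.
by rewrite !scalerA -scalerDl /direction /= mulrN mulrC subrr scale0r.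
Qed.

Lemma collapse_homog alpha beta d p : p \is d.-homog ->
  collapse alpha beta p = eval_on alpha p *: beta ^+ d.
Proof.
move=> hp; rewrite /collapse comp_mpolyEX eval_onE mevalE scaler_suml.
rewrite big_seq [RHS]big_seq; apply: eq_bigr => m /(dhomog_mf hp) /= dm.
rewrite comp_mpolyX -scalerA; congr (_ *: _).
rewrite -dm mdegE -prodrXr -scaler_prod; apply: eq_bigr => i _.
by rewrite tnth_mktuple exprZn.
Qed.

(** Congruence modulo alpha is compatible with the ring operations, so only the
    two variables have to be looked at.  With beta = a x + b y,
    x - alpha_y beta = - b alpha and y + alpha_x beta = a alpha. *)
Lemma collapse_congr alpha a b p : linear_form alpha ->
  eval_on alpha (lin a b) = 1 ->
  in_ideal_pow alpha 1 (p - collapse alpha (lin a b) p).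
Proof.
move=> ha e1.
have h1 : in_ideal_pow alpha 1 (1 - collapse alpha (lin a b) 1).
  by rewrite collapse1 subrr; apply: in_ideal_pow0.
have hX i : in_ideal_pow alpha 1 ('X_i - collapse alpha (lin a b) 'X_i).
  exists (if i == 0 then - b else a)%:MP.
  rewrite collapseX expr1 [X in _ = _ * X](linear_formE ha) /direction.
  move: e1; rewrite eval_on_lin.
  set x := mcoeff U_(0%R)%MM alpha; set y := mcoeff U_(1%R)%MM alpha => e1.
  rewrite mul_mpolyC !scale_lin; case: (I2_case i) => ->.
  - by rewrite mpolyX0_lin subr_lin /=; congr lin; rewrite -?e1; ring.
  - by rewrite mpolyX1_lin subr_lin /=; congr lin; rewrite -?e1; ring.
have hM q r : in_ideal_pow alpha 1 (q - collapse alpha (lin a b) q) ->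
   in_ideal_pow alpha 1 (r - collapse alpha (lin a b) r) ->
   in_ideal_pow alpha 1 (q * r - collapse alpha (lin a b) (q * r)).
  rewrite collapseM; set q' := collapse _ _ q; set r' := collapse _ _ r.
  move=> hq hr.
  have -> : q * r - q' * r' = r * (q - q') + q' * (r - r') by ring.
  by apply: in_ideal_powD; apply: in_ideal_powMl.
elim/mpolyind: p => [|c m p _ _ hp].
  by rewrite /collapse raddf0 subrr; apply: in_ideal_pow0.
rewrite collapseD opprD addrACA; apply: in_ideal_powD => //.
rewrite collapseZ -scalerBr -mul_mpolyC; apply: in_ideal_powMl.
rewrite mpolyXE_id.
apply: (big_ind (fun q => in_ideal_pow alpha 1
                            (q - collapse alpha (lin a b) q))) => // i _.
by elim: (m i) => [|k IH]; rewrite ?expr0 // exprS; apply: hM.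
Qed.

Lemma ideal1P alpha a b p : linear_form alpha ->
  eval_on alpha (lin a b) = 1 ->
  in_ideal_pow alpha 1 p <-> collapse alpha (lin a b) p = 0.
Proof.
move=> ha e1; split=> [[h ->]|e].
  by rewrite expr1 collapseM collapse_self ?mulr0.
by have := collapse_congr p ha e1; rewrite e subr0.
Qed.

(** The ideal (alpha) is the kernel of a morphism to an integral domain. *)
Lemma linear_form_prime alpha p q : linear_form alpha -> alpha != 0 ->
  in_ideal_pow alpha 1 (p * q) ->
  in_ideal_pow alpha 1 p \/ in_ideal_pow alpha 1 q.
Proof.
move=> ha nz; have [a [b e1]] := exists_transverse ha nz.
rewrite !(ideal1P _ ha e1) collapseM => /eqP; rewrite mulf_eq0.
by case/orP=> /eqP; [left|right].
Qed.

(** On the line, p restricts to a monomial c t^d, which a single nonzero point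
    distinguishes from 0 over every field. *)
Lemma ideal1_eval_on alpha d p : linear_form alpha -> alpha != 0 ->
  p \is d.-homog -> in_ideal_pow alpha 1 p <-> eval_on alpha p = 0.
Proof.
move=> ha nz hp; have [a [b e1]] := exists_transverse ha nz.
rewrite (ideal1P _ ha e1) (collapse_homog _ _ hp).
split=> [/eqP|->]; last by rewrite scale0r.
rewrite scaler_eq0 expf_eq0 => /orP[/eqP//|/andP[_ /eqP b0]].
by move: e1; rewrite b0 eval_onE meval0 => /eqP; rewrite eq_sym oner_eq0.
Qed.

End LinearForms.

(** * Lines and their defining forms *)

Section Hyperplanes.
Variable K : fieldType.
Local Notation S := {mpoly K[2]}.
Implicit Types (alpha beta p q : S) (H : hyperplane K).

Lemma dim_hyperplane H : \dim (val H) = 1%N.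
Proof. by apply/eqP; apply: (valP H). Qed.

Lemma is_ker_neq0 alpha H : is_ker alpha H -> alpha != 0.
Proof.
move=> hk; apply/eqP => a0.
have : val H = fullv.
  by apply/vspaceP => v; rewrite hk a0 meval0 eqxx memvf.
by move/(congr1 (fun U => \dim U)); rewrite (dim_hyperplane H) dimvf.
Qed.

Lemma is_ker_dir alpha H : linear_form alpha -> is_ker alpha H ->
  val H = <[(\row_i direction alpha i)%R]>%VS.
Proof.
move=> ha hk; apply/esym/eqP; rewrite eqEdim (dim_hyperplane H) dim_vline.
rewrite -memvE hk; apply/andP; split; last first.
  have [i ai] := linear_form_neq0 ha (is_ker_neq0 hk).
  rewrite lt0b; apply: contra ai => /eqP/rowP e.
  have := e 0; have := e 1; rewrite !mxE /direction /= => /eqP.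
  by rewrite oppr_eq0 => /eqP a0 a1; case: (I2_case i) => ->; apply/eqP.
rewrite -[X in _ == X](eval_on_self ha) eval_onE; apply/eqP.
by apply: meval_eq => i; rewrite mxE.
Qed.

Lemma is_ker_eval alpha beta H H' : linear_form alpha ->
  is_ker alpha H -> is_ker beta H' -> (eval_on alpha beta == 0) = (H == H').
Proof.
move=> ha hk hk'.
have -> : (eval_on alpha beta == 0) = (val H <= val H')%VS.
  rewrite (is_ker_dir ha hk) -memvE hk' eval_onE.
  by congr (_ == 0); apply: meval_eq => i; rewrite mxE.
by rewrite -val_eqE /= eqEdim (dim_hyperplane H) (dim_hyperplane H') andbT.
Qed.

Lemma exists_is_ker H : exists alpha, linear_form alpha /\ is_ker alpha H.
Proof.
pose v := vpick (val H).
have vnz : v != 0 by rewrite vpick0 -dimv_eq0 (dim_hyperplane H).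
have vH : val H = <[v]>%VS.
  apply/esym/eqP.
  by rewrite eqEdim (dim_hyperplane H) dim_vline vnz -memvE memv_pick.
exists (lin (v 0 1) (- v 0 0)); split; first exact: linear_form_lin.
move=> u; rewrite vH meval_lin; apply/vlineP/eqP => [[k ->]|e].
  by rewrite !mxE; ring.
have [v0|v0] := eqVneq (v 0 0) 0.
- have v1 : v 0 1 != 0.
    apply: contra vnz => /eqP v1; apply/eqP/rowP => i.
    by case: (I2_case i) => ->; rewrite mxE.
  exists (u 0 1 / v 0 1); apply/rowP => i; rewrite mxE.
  case: (I2_case i) => ->; last by rewrite divfK.
  move: e; rewrite v0 oppr0 mul0r addr0 mulr0 => /eqP.
  by rewrite mulf_eq0 (negPf v1) => /eqP.
- exists (u 0 0 / v 0 0); apply/rowP => i; rewrite mxE.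
  case: (I2_case i) => ->; first by rewrite divfK.
  apply: (mulfI v0); rewrite mulrA [v 0 0 * (_ / _)]mulrC divfK //.
  by apply/eqP; rewrite eq_sym -subr_eq0 -mulNr mulrC e.
Qed.

Lemma is_ker_proportional alpha beta H :
  linear_form alpha -> linear_form beta -> is_ker alpha H -> is_ker beta H ->
  exists c, beta = c *: alpha.
Proof.
move=> ha hb ka kb; apply: (proportional ha (is_ker_neq0 ka) hb).
by apply/eqP; rewrite (is_ker_eval ha ka kb).
Qed.

Lemma in_ideal_pow_same_ker alpha beta H n p :
  linear_form alpha -> linear_form beta -> is_ker alpha H -> is_ker beta H ->
  in_ideal_pow alpha n p -> in_ideal_pow beta n p.
Proof.
move=> ha hb ka kb [h ->]; have [c ->] := is_ker_proportional hb ha kb ka.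
by exists (c ^+ n *: h); rewrite exprZn -scalerAr -scalerAl.
Qed.

End Hyperplanes.

(** * Derivations *)

Section Derivations.
Variable K : fieldType.
Local Notation S := {mpoly K[2]}.
Implicit Types (alpha beta p q : S) (H : hyperplane K).
Implicit Types (theta t : derivation K).

Lemma der_appE theta alpha : linear_form alpha ->
  der_app theta alpha
  = alpha@_U_(0) *: theta 0 0 + alpha@_U_(1) *: theta 0 1.
Proof.
have subm_self (m : 'X_{1..2}) : (m - m)%MM = 0%MM.
  by apply/mnmP => i; rewrite mnmBE subnn mnm0E.
move=> ha; rewrite /der_app big_I2 {1 2}(linear_formE ha) /lin.
rewrite !mderivD !mderivZ !mderivX !mnm1E /=.
rewrite !scale0r !scaler0 addr0 add0r !scale1r !subm_self !mpolyX0.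
by rewrite -!scalerAr !mulr1.
Qed.

Lemma der_appD t theta p :
  der_app (t + theta) p = der_app t p + der_app theta p.
Proof. by rewrite -big_split; apply: eq_bigr => i _; rewrite mxE mulrDl. Qed.

Lemma der_appZ q theta p : der_app (q *: theta) p = q * der_app theta p.
Proof. by rewrite mulr_sumr; apply: eq_bigr => i _; rewrite mxE mulrA. Qed.

Lemma der_appZr c theta p : der_app theta (c *: p) = c *: der_app theta p.
Proof.
by rewrite scaler_sumr; apply: eq_bigr => i _; rewrite mderivZ scalerAr.
Qed.

Lemma der_app_same_ker alpha beta H n theta :
  linear_form alpha -> linear_form beta -> is_ker alpha H -> is_ker beta H ->
  in_ideal_pow alpha n (der_app theta alpha) ->
  in_ideal_pow beta n (der_app theta beta).
Proof.
move=> ha hb ka kb hn; apply: (in_ideal_pow_same_ker ha hb ka kb).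
have [c ->] := is_ker_proportional ha hb ka kb.
by rewrite der_appZr -mul_mpolyC; apply: in_ideal_powMl.
Qed.

Lemma der_app_homog d theta alpha : linear_form alpha -> homog_der d theta ->
  der_app theta alpha \is d.-homog.
Proof.
by move=> ha [_ h]; rewrite der_appE //; apply: dhomogD; apply: dhomogZ.
Qed.

Lemma deg_derE d theta : homog_der d theta -> deg_der theta = d.
Proof.
move=> [nz h]; rewrite /deg_der.
have -> : (\max_(i < 2) msize (theta 0%R i) = d.+1)%N; last by [].
apply/eqP; rewrite eqn_leq; apply/andP; split.
- apply/bigmax_leqP => i _.
  have [->|ti] := eqVneq (theta 0%R i) 0%R; first by rewrite msize0.
  by rewrite (dhomog_msize_eq (h i)).
- have [i ti] : exists i, theta 0 i != 0.
    apply/existsP; apply: contraR nz; rewrite negb_exists => /forallP e.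
    by apply/eqP/rowP => i; rewrite mxE; apply/eqP; rewrite -[_ == _]negbK.
  by apply: leq_trans (leq_bigmax i); rewrite (dhomog_msize_eq (h i)).
Qed.

Lemma homog_derZ d e q theta : q != 0 -> q \is e.-homog -> homog_der d theta ->
  homog_der (e + d) (q *: theta).
Proof.
move=> qnz hq [nz h]; split=> [|i]; last by rewrite mxE; apply: dhomogM.
apply: contra nz => /eqP/rowP e0; apply/eqP/rowP => i.
by have /eqP := e0 i; rewrite !mxE mulf_eq0 (negPf qnz) => /eqP.
Qed.

Lemma is_quot_comb t1 t2 alpha m f g a b : is_quot t1 alpha m f ->
  is_quot t2 alpha m g -> is_quot (a *: t1 + b *: t2) alpha m (a * f + b * g).
Proof.
by move=> hf hg; rewrite /is_quot der_appD !der_appZ -hf -hg; ring.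
Qed.

Lemma is_quot_inj theta alpha m f g : alpha != 0 ->
  is_quot theta alpha m f -> is_quot theta alpha m g -> f = g.
Proof.
rewrite /is_quot => nz <- /mulIf e; apply/esym/e.
by rewrite expf_neq0.
Qed.

Lemma is_quot_ideal1 d theta alpha m f : linear_form alpha -> alpha != 0 ->
  homog_der d theta -> is_quot theta alpha m f ->
  in_ideal_pow alpha 1 f <-> eval_on alpha f = 0.
Proof.
move=> ha nz ht hf; apply: (@ideal1_eval_on _ _ (d - 1 * m)) => //.
apply: (dhomog_cancel (expf_neq0 m nz) (dhomogMn m ha)).
by rewrite hf; apply: der_app_homog.
Qed.

End Derivations.

(** * Raising one multiplicity *)

Section Log.
Variable K : fieldType.
Local Notation S := {mpoly K[2]}.
Implicit Types (alpha beta p q f g : S) (H : hyperplane K).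
Implicit Types (theta t : derivation K) (mu nu : multiarr K).

Lemma logDD mu t theta : logD mu t -> logD mu theta -> logD mu (t + theta).
Proof.
move=> h1 h2 alpha H ha nz k; rewrite der_appD.
by apply: in_ideal_powD; [apply: h1|apply: h2].
Qed.

Lemma logDZ mu p theta : logD mu theta -> logD mu (p *: theta).
Proof.
move=> h alpha H ha nz k; rewrite der_appZ.
by apply: in_ideal_powMl; apply: h.
Qed.

Lemma logD_quot nu H alpha theta : linear_form alpha -> is_ker alpha H ->
  logD nu theta -> exists f, is_quot theta alpha (nu H) f.
Proof.
move=> ha ka h; have [f e] := h alpha H ha (is_ker_neq0 ka) ka.
by exists f.
Qed.

Lemma decrE mu H H' : decr mu H H' = if H' == H then (mu H).-1 else mu H'.
Proof. exact: fsfun_withE. Qed.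

Lemma decr_at mu H : H \in finsupp mu -> mu H = (decr mu H H).+1.
Proof. by rewrite mem_finsupp decrE eqxx => /=; case: (mu H). Qed.

Lemma logD_decr mu H theta : logD mu theta -> logD (decr mu H) theta.
Proof.
move=> h alpha H' ha nz k; have [u e] := h alpha H' ha nz k.
rewrite e decrE; case: eqP => [->|_]; last by exists u.
case: (mu H) => [|n]; first by exists u.
by exists (u * alpha); rewrite exprS mulrA.
Qed.

Lemma logD_incr mu H alpha theta f : H \in finsupp mu ->
  linear_form alpha -> is_ker alpha H -> logD (decr mu H) theta ->
  is_quot theta alpha (decr mu H H) f ->
  logD mu theta <-> in_ideal_pow alpha 1 f.
Proof.
move=> Hmu ha ka ht hf; have nz := is_ker_neq0 ka; split=> [h|[h fe]].
- have [u] := h alpha H ha nz ka.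
  rewrite -hf (decr_at Hmu) exprS mulrA => /mulIf e.
  by exists u; apply: e; rewrite expf_neq0.
- move=> beta H' hb nzb kb.
  have := ht beta H' hb nzb kb; rewrite decrE.
  have [eH _|//] := eqVneq H' H; rewrite eH in kb *.
  apply: (der_app_same_ker ha hb ka kb); exists h.
  by rewrite (decr_at Hmu) exprS mulrA -hf fe.
Qed.

Lemma avoiding_product alpha H nu (s : seq (hyperplane K)) :
  linear_form alpha -> is_ker alpha H ->
  exists Q, ~ in_ideal_pow alpha 1 Q /\
    forall H' beta, H' \in s -> H' != H -> linear_form beta ->
      is_ker beta H' -> in_ideal_pow beta (nu H') Q.
Proof.
move=> ha ka; have nz := is_ker_neq0 ka.
have ndvd n beta : linear_form beta -> eval_on alpha beta != 0 ->
    ~ in_ideal_pow alpha 1 (beta ^+ n).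
  move=> hb ne /(ideal1_eval_on ha nz (dhomogMn n hb)); apply/eqP.
  by rewrite eval_onE rmorphXn expf_neq0.
elim: s => [|H0 s [Q [nQ hQ]]].
  (* Q = 1, as the 0-th power of a form that does not vanish on H *)
  have [a [b e1]] := exists_transverse ha nz.
  exists (lin a b ^+ 0); split=> //; apply: ndvd; first exact: linear_form_lin.
  by rewrite e1 oner_eq0.
have [e|ne] := eqVneq H0 H.
  exists Q; split=> // H' beta; rewrite inE e => /orP[->//|]; exact: hQ.
have [b0 [hb0 kb0]] := exists_is_ker H0.
exists (b0 ^+ nu H0 * Q); split.
  move=> /(linear_form_prime ha nz) [|//]; apply: ndvd => //.
  by rewrite (is_ker_eval ha ka kb0) eq_sym.
move=> H' beta; rewrite inE => /orP[/eqP-> _ hb kb|h1 h2 hb kb].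
- rewrite mulrC; apply: in_ideal_powMl.
  by apply: (in_ideal_pow_same_ker hb0 hb kb0 kb); apply: in_ideal_pow_self.
- by apply: in_ideal_powMl; apply: hQ.
Qed.

(** The witness is Q alpha^(nu H) d/dx or Q alpha^(nu H) d/dy, according to which
    coefficient of alpha is nonzero, with Q from [avoiding_product]. *)
Lemma exists_exact_contact nu H alpha : linear_form alpha -> is_ker alpha H ->
  exists theta f, [/\ logD nu theta, is_quot theta alpha (nu H) f
                    & ~ in_ideal_pow alpha 1 f].
Proof.
move=> ha ka; have nz := is_ker_neq0 ka.
have [Q [nQ hQ]] := avoiding_product nu (finsupp nu) ha ka.
have [i ai] := linear_form_neq0 ha nz.
pose D : derivation K := delta_mx 0 i.
have De : der_app D alpha = (alpha@_U_(i))%:MP.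
  rewrite (der_appE _ ha) !mxE eqxx /= -[_%:MP]mulr1 mul_mpolyC.
  by case: (I2_case i) => ->; rewrite /= ?scaler0 ?addr0 ?add0r.
exists ((Q * alpha ^+ nu H) *: D), (Q * (alpha@_U_(i))%:MP); split.
- move=> beta H' hb nzb kb; rewrite der_appZ mulrC; apply: in_ideal_powMl.
  have [e|ne] := eqVneq H' H.
    rewrite e in kb *; apply: in_ideal_powMl.
    by apply: (in_ideal_pow_same_ker ha hb ka kb); apply: in_ideal_pow_self.
  rewrite mulrC; apply: in_ideal_powMl.
  have [Hs|/fsfun_dflt ->] := boolP (H' \in finsupp nu); first exact: hQ.
  by exists Q; rewrite expr0 mulr1.
- by rewrite /is_quot der_appZ De mulrAC.
- (* if alpha divided the nonzero constant alpha_i, it would divide Q too *)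
  move=> /(linear_form_prime ha nz) [//|[h e]]; apply: nQ.
  exists (Q * ((alpha@_U_(i))^-1)%:MP * h).
  by rewrite -mulrA -e -mulrA -mpolyCM mulVf // mulr1.
Qed.

Lemma basis_contact nu H alpha t1 t2 f g :
  linear_form alpha -> is_ker alpha H -> basis_logD nu t1 t2 ->
  is_quot t1 alpha (nu H) f -> is_quot t2 alpha (nu H) g ->
  ~ (in_ideal_pow alpha 1 f /\ in_ideal_pow alpha 1 g).
Proof.
move=> ha ka [_ _ _ gen] hf hg [df dg].
have [theta [h [/gen [a [b ->]] hh]]] := exists_exact_contact nu ha ka.
apply; rewrite (is_quot_inj (is_ker_neq0 ka) hh (is_quot_comb a b hf hg)).
by apply: in_ideal_powD; apply: in_ideal_powMl.
Qed.

Lemma basis_swap mu t1 t2 : basis_logD mu t1 t2 -> basis_logD mu t2 t1.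
Proof.
move=> [h1 h2 free gen]; split=> // [a b|theta /gen [a [b ->]]].
  by rewrite addrC => /free [].
by exists b, a; rewrite addrC.
Qed.

Lemma basis_shear mu t1 t2 q :
  basis_logD mu t1 t2 -> basis_logD mu (t1 + q *: t2) t2.
Proof.
move=> [h1 h2 free gen]; split=> //.
- by apply: logDD => //; apply: logDZ.
- move=> a b; rewrite scalerDr scalerA -addrA -scalerDl => /free [-> ].
  by rewrite mul0r add0r.
- move=> theta /gen [a [b ->]]; exists a, (b - a * q).
  by rewrite scalerDr scalerA -addrA -scalerDl [a * q + _]addrC subrK.
Qed.

(** If alpha divides f, then alpha divides a f + b g iff it divides b g, that is
    iff it divides b, since alpha is prime and does not divide g. *)
Lemma basis_step mu H alpha t1 t2 f g : H \in finsupp mu ->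
  linear_form alpha -> is_ker alpha H -> basis_logD (decr mu H) t1 t2 ->
  is_quot t1 alpha (decr mu H H) f -> is_quot t2 alpha (decr mu H H) g ->
  in_ideal_pow alpha 1 f -> ~ in_ideal_pow alpha 1 g ->
  basis_logD mu t1 (alpha *: t2).
Proof.
move=> Hmu ha ka [h1 h2 free gen] hf hg df ndg; have nz := is_ker_neq0 ka.
split.
- exact/(logD_incr Hmu ha ka h1 hf).
- apply/(logD_incr (f := alpha * g) Hmu ha ka); first exact: logDZ.
    by rewrite /is_quot der_appZ -hg mulrA.
  by exists g; rewrite mulrC.
- move=> a b; rewrite scalerA => /free [-> /eqP].
  by rewrite mulf_eq0 (negPf nz) orbF => /eqP.
- move=> theta ht; have ht' := logD_decr H ht.
  have [a [b e]] := gen theta ht'; rewrite e in ht ht' *.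
  have := (logD_incr Hmu ha ka ht' (is_quot_comb a b hf hg)).1 ht.
  move=> dab; have : in_ideal_pow alpha 1 (b * g).
    have -> : b * g = (- a) * f + (a * f + b * g) by ring.
    by apply: in_ideal_powD => //; apply: in_ideal_powMl.
  move=> /(linear_form_prime ha nz) [[h ->]|//].
  by exists a, h; rewrite scalerA.
Qed.

Lemma shear_homog mu d t1 t2 q : basis_logD mu t1 t2 ->
  homog_der d t1 -> (forall i, (q *: t2) 0 i \is d.-homog) ->
  homog_der d (t1 + q *: t2).
Proof.
move=> [_ _ free _] [_ h1] h2; split=> [|i]; last first.
  by rewrite mxE; apply: dhomogD.
apply/eqP => e; have [] := free 1 q; first by rewrite scale1r.
by move=> /eqP; rewrite oner_eq0.
Qed.

(** * The two algorithms *)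

Lemma ALG1_ordered_correct mu H alpha t1 t2 t1' t2' : H \in finsupp mu ->
  linear_form alpha -> is_ker alpha H -> homog_basis (decr mu H) t1 t2 ->
  (deg_der t2 <= deg_der t1)%N ->
  ALG1_ordered t1 t2 alpha (decr mu H H) t1' t2' ->
  homog_basis mu t1' t2'.
Proof.
move=> Hmu ha ka [B [d1 hd1] [d2 hd2]]; have nz := is_ker_neq0 ka.
rewrite (deg_derE hd1) (deg_derE hd2) => le21.
have [f hf] : exists f, is_quot t1 alpha (decr mu H H) f.
  by case: B => h _ _ _; apply: logD_quot h.
case=> [g hg g0|g f' hg g0 hf' f0|g f' q hg g0 hf' f0].
- split; last by exists d2.
    apply/basis_swap/(basis_step Hmu ha ka (basis_swap B) hg hf).
      exact/(is_quot_ideal1 ha nz hd2 hg).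
    move=> df; apply: (basis_contact ha ka B hf hg); split=> //.
    exact/(is_quot_ideal1 ha nz hd2 hg).
  by exists (1 + d1)%N; apply: homog_derZ.
- split; [|by exists d1|by exists (1 + d2)%N; apply: homog_derZ].
  apply: (basis_step Hmu ha ka B hf' hg).
    exact/(is_quot_ideal1 ha nz hd1 hf').
  by move/(is_quot_ideal1 ha nz hd2 hg).
- rewrite (deg_derE hd1) (deg_derE hd2) => hq fq0.
  have hd : homog_der d1 (t1 + q *: t2).
    apply: (shear_homog B hd1) => i.
    by rewrite mxE -(subnK le21); apply: dhomogM => //; case: hd2.
  have hfq : is_quot (t1 + q *: t2) alpha (decr mu H H) (f' + q * g).
    by rewrite -[t1]scale1r -[f']mul1r; apply: is_quot_comb.
  split; [|by exists d1|by exists (1 + d2)%N; apply: homog_derZ].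
  apply: (basis_step Hmu ha ka (basis_shear q B) hfq hg).
    apply/(is_quot_ideal1 ha nz hd hfq).
    by rewrite eval_onE mevalD mevalM mulrC.
  by move/(is_quot_ideal1 ha nz hd2 hg).
Qed.

Lemma ALG1_correct mu H alpha t1 t2 t1' t2' : H \in finsupp mu ->
  linear_form alpha -> is_ker alpha H -> homog_basis (decr mu H) t1 t2 ->
  ALG1 t1 t2 alpha (decr mu H H) t1' t2' -> homog_basis mu t1' t2'.
Proof.
move=> Hmu ha ka B; rewrite /ALG1; case: ltnP => [/ltnW|] le21.
  apply: (ALG1_ordered_correct Hmu ha ka) le21.
  by case: B => /basis_swap.
exact: (ALG1_ordered_correct Hmu ha ka B).
Qed.

Lemma ALG1_ordered_progress nu H alpha t1 t2 :
  linear_form alpha -> is_ker alpha H -> logD nu t1 -> logD nu t2 ->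
  exists t1' t2', ALG1_ordered t1 t2 alpha (nu H) t1' t2'.
Proof.
move=> ha ka h1 h2.
have [f hf] := logD_quot ha ka h1; have [g hg] := logD_quot ha ka h2.
have [g0|/eqP g0] := eqVneq (eval_on alpha g) 0.
  by exists (alpha *: t1), t2; apply: ALG1_g0 hg g0.
have [f0|/eqP f0] := eqVneq (eval_on alpha f) 0.
  by exists t1, (alpha *: t2); apply: ALG1_f0 hg g0 hf f0.
(* powers of a linear form of value 1 provide every degree and every value *)
have [a [b e1]] := exists_transverse ha (is_ker_neq0 ka).
pose d := (deg_der t1 - deg_der t2)%N.
pose q := (- eval_on alpha f / eval_on alpha g) *: lin a b ^+ d.
exists (t1 + q *: t2), (alpha *: t2); apply: (ALG1_q hg g0 hf f0).
  apply: dhomogZ; rewrite -[X in X.-homog]mul1n; apply: dhomogMn.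
  exact: linear_form_lin.
have -> : eval_on alpha q = - eval_on alpha f / eval_on alpha g.
  by rewrite [LHS]mevalZ rmorphXn /= -eval_onE e1 expr1n mulr1.
by rewrite mulrC divfK ?subrr //; apply/eqP.
Qed.

Lemma ALG1_progress nu H alpha t1 t2 :
  linear_form alpha -> is_ker alpha H -> homog_basis nu t1 t2 ->
  exists t1' t2', ALG1 t1 t2 alpha (nu H) t1' t2'.
Proof.
move=> ha ka [[h1 h2 _ _] _ _]; rewrite /ALG1.
by case: ifP => _; apply: ALG1_ordered_progress.
Qed.

Lemma homog_basis0 mu : finsupp mu = fset0 -> homog_basis mu (d_x K) (d_y K).
Proof.
move=> e.
have mu0 H : mu H = 0%N by apply: fsfun_dflt; rewrite e.
have all theta : logD mu theta.
  move=> alpha H _ _ _; rewrite mu0.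
  by exists (der_app theta alpha); rewrite mulr1.
have hd i : homog_der 0 (delta_mx 0 i : derivation K).
  split=> [|j].
    apply/eqP => /matrixP /(_ 0 i); rewrite !mxE !eqxx /= => /eqP.
    by rewrite oner_eq0.
  by rewrite mxE; case: (_ && _); [exact: dhomog1|exact: dhomog0].
split; [split=> //|exists 0%N; exact: hd|exists 0%N; exact: hd].
- move=> a b /rowP e0; have := e0 0; have := e0 1.
  by rewrite !mxE /= !mulr0 !mulr1 addr0 add0r.
- move=> theta _; exists (theta 0 0), (theta 0 1); apply/rowP => i.
  rewrite !mxE; case: (I2_case i) => -> /=.
    by rewrite mulr1 mulr0 addr0.
  by rewrite mulr1 mulr0 add0r.
Qed.

Lemma ALG3_correct mu t1 t2 : ALG3 mu t1 t2 -> homog_basis mu t1 t2.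
Proof.
elim=> {mu t1 t2} [mu|mu H alpha t1' t2' t1 t2 Hmu _ B ha ka h].
  exact: homog_basis0.
exact: ALG1_correct Hmu ha ka B h.
Qed.

Lemma decr_ind (P : multiarr K -> Prop) :
  (forall mu, (forall H, H \in finsupp mu -> P (decr mu H)) -> P mu) ->
  forall mu, P mu.
Proof.
move=> step mu.
(* A is a fixed finite set, unlike the support, which can shrink; the
   multiplicities can thus be summed over the same lines throughout *)
have [A sub] : exists A : {fset hyperplane K}, (finsupp mu `<=` A)%fset.
  by exists (finsupp mu); apply: fsubset_refl.
have [n le_n] := ubnP (\sum_(H <- A) mu H)%N.
elim: n mu sub le_n => // n IH mu sub le_n; apply: step => H Hmu.
apply: IH.
  rewrite /decr finsupp_with; case: ifP => _.
    exact: fsubset_trans (fsubD1set _ _) sub.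
  by rewrite fsubUset fsub1set sub (fsubsetP sub).
have HA : H \in A := fsubsetP sub _ Hmu.
move: le_n; rewrite !(big_fsetD1 H HA) /= {1}(decr_at Hmu) addSn ltnS.
rewrite (eq_big_seq (fun H' => decr mu H H')) // => H'.
by rewrite !inE decrE => /andP[/negPf -> _].
Qed.

End Log.

Theorem theorem3p3 (K : fieldType) (mu : multiarr K) :
  [/\ ALG3_terminates mu,
      exists t1 t2 : derivation K, ALG3 mu t1 t2
    & forall t1 t2 : derivation K, ALG3 mu t1 t2 -> homog_basis mu t1 t2].
Proof.
split; last exact: ALG3_correct.
- elim/decr_ind: mu => mu IH; split=> // [H _|]; first exact: exists_is_ker.
  move=> H alpha t1 t2 _ /ALG3_correct B ha ka; exact: ALG1_progress B.
- elim/decr_ind: mu => mu IH.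
  have [e|[H Hmu]] := fset_0Vmem (finsupp mu).
    by exists (d_x K), (d_y K); apply: ALG3_empty.
  have [t1 [t2 h]] := IH H Hmu; have [alpha [ha ka]] := exists_is_ker H.
  have [t1' [t2' h']] := ALG1_progress ha ka (ALG3_correct h).
  by exists t1', t2'; apply: ALG3_rec Hmu h ha ka h'.
Qed.
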